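(* Let $p\le n$ be positive integers, $\rho>0$, let $f:\mathrm{Sp}(2p,2n)\to\mathbb{R}$ be a function, let $X\in\mathrm{Sp}(2p,2n)$, and let $\nabla\bar f(X)$ be the Euclidean gradient at $X$ of any smooth extension $\bar f$ of $f$ around $X$ in $\mathbb{R}^{2n\times 2p}$. Then the Riemannian gradient of $f$ at $X$ with respect to the metric $g_\rho$ is $$\mathrm{grad}_\rho f(X)=\rho XJ_{2p}\,\mathrm{sym}(J_{2p}^\top X^\top\nabla\bar f(X))+J_{2n}X_\perp X_\perp^\top J_{2n}^\top\nabla\bar f(X)=S_XJ_{2n}X,$$ where $S_X=(H_X\nabla\bar f(X))(XJ_{2p})^\top+XJ_{2p}(H_X\nabla\bar f(X))^\top$ with $H_X=\frac\rho2XX^\top+J_{2n}X_\perp X_\perp^\top J_{2n}^\top$.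
   Context: For a positive integer $m$, $J_{2m}=\begin{bmatrix} 0 & I_m \\ -I_m & 0 \end{bmatrix}$. For a square matrix $A$, $\mathrm{sym}(A)=\frac12(A+A^\top)$. The symplectic Stiefel manifold is $\mathrm{Sp}(2p,2n)=\{X\in\mathbb{R}^{2n\times 2p}: X^\top J_{2n}X=J_{2p}\}$, an embedded submanifold of $\mathbb{R}^{2n\times 2p}$, with tangent space $\mathrm{T}_X\mathrm{Sp}(2p,2n)$ at $X$. $X_\perp\in\mathbb{R}^{2n\times(2n-2p)}$ denotes a full rank matrix whose columns span the orthogonal complement of the column span of $X$ (the empty matrix when $p=n$, in which case terms involving it vanish); then $E=[XJ_{2p}\;\;J_{2n}X_\perp]$ is invertible. The metric $g_\rho$ (depending also on the choice of $X_\perp$) is given at $X$ by $g_\rho(Z_1,Z_2)=\frac1\rho\mathrm{tr}(W_1^\top W_2)+\mathrm{tr}(K_1^\top K_2)$ where $\begin{bmatrix} W_i \\ K_i \end{bmatrix}=E^{-1}Z_i$. The Riemannian gradient $\mathrm{grad}_\rho f(X)$ is the unique element of $\mathrm{T}_X\mathrm{Sp}(2p,2n)$ satisfying $g_\rho(\mathrm{grad}_\rho f(X),Z)=\mathrm{D}\bar f(X)[Z]=\mathrm{tr}(\nabla\bar f(X)^\top Z)$ for all $Z\in\mathrm{T}_X\mathrm{Sp}(2p,2n)$. *)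

(* Defs.v *)
From HB Require Import structures.
From mathcomp Require Import all_boot all_order all_algebra.
From mathcomp Require Import all_classical all_reals all_analysis.

Set Implicit Arguments.
Unset Strict Implicit.
Unset Printing Implicit Defensive.

Import Order.TTheory GRing.Theory Num.Theory.
Import numFieldNormedType.Exports.

Local Open Scope classical_set_scope.
Local Open Scope ring_scope.

(* C^k on an open set U of a finite-dimensional space, by recursion on k. *)
Fixpoint Ck_on (R : realType) (V W : normedModType R) (k : nat) (U : set V)
    (f : V -> W) {struct k} : Prop :=
  match k with
  | 0%N => forall x, U x -> {for x, continuous f}
  | k'.+1 => (forall x, U x -> differentiable f x) /\
             (forall v : V, Ck_on k' U ('D_v f))
  end.

Definition smooth_on (R : realType) (V W : normedModType R) (U : set V)
    (f : V -> W) : Prop :=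
  forall k, Ck_on k U f.

Definition sym (R : realType) (m : nat) (A : 'M[R]_m) : 'M[R]_m :=
  2^-1 *: (A + A^T).

Definition J (R : realType) (m : nat) : 'M[R]_(m + m) :=
  block_mx 0 1%:M (- 1%:M) 0.
Arguments J {R} m.

(* The dimensions 2n and 2p are written n + n and p + p throughout. *)
Definition Sp (R : realType) (p n : nat) : set 'M[R]_(n + n, p + p) :=
  [set X | X^T *m J n *m X = J p].
Arguments Sp : clear implicits.

(* Velocities at 0 of smooth curves in Sp(2p, 2n) through X; only the values
   of the curve near 0 matter. *)
Definition tangent (R : realType) (p n : nat) (X : 'M[R]_(n + n, p + p)) :
    set 'M[R]_(n + n, p + p) :=
  [set Z | exists (c : R -> 'M[R]_(n + n, p + p)) (I : set R),
    [/\ open I, I 0, smooth_on I c, (forall t, I t -> Sp R p n (c t)) &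
        c 0 = X /\ derive1 c 0 = Z]].

(* Column spans are expressed as row spaces of transposes. *)
Definition is_perp (R : realType) (p n : nat) (X : 'M[R]_(n + n, p + p))
    (Xp : 'M[R]_(n + n, (n + n) - (p + p))) : Prop :=
  \rank Xp = ((n + n) - (p + p))%N /\
  forall v : 'cV[R]_(n + n),
    (v^T <= Xp^T)%MS <->
    (forall u : 'cV[R]_(n + n), (u^T <= X^T)%MS -> u^T *m v = 0).

Section Metric.
Variables (R : realType) (p n : nat) (le_pn : (p <= n)%N).

Lemma dimE : ((p + p) + ((n + n) - (p + p)) = n + n)%N.
Proof. by rewrite subnKC // leq_add. Qed.

Definition E (X : 'M[R]_(n + n, p + p))
    (Xp : 'M[R]_(n + n, (n + n) - (p + p))) : 'M[R]_(n + n) :=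
  castmx (erefl, dimE) (row_mx (X *m J p) (J n *m Xp)).

Definition coords (X : 'M[R]_(n + n, p + p))
    (Xp : 'M[R]_(n + n, (n + n) - (p + p))) (Z : 'M[R]_(n + n, p + p)) :
    'M[R]_((p + p) + ((n + n) - (p + p)), p + p) :=
  castmx (esym dimE, erefl) (invmx (E X Xp) *m Z).

Definition gmetric (rho : R) (X : 'M[R]_(n + n, p + p))
    (Xp : 'M[R]_(n + n, (n + n) - (p + p))) (Z1 Z2 : 'M[R]_(n + n, p + p)) : R :=
  let W Z := usubmx (coords X Xp Z) in
  let K Z := dsubmx (coords X Xp Z) in
  rho^-1 * \tr ((W Z1)^T *m W Z2) + \tr ((K Z1)^T *m K Z2).

End Metric.

Definition smooth_extension (R : realType) (p n : nat) (f : Sp R p n -> R)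
    (X : 'M[R]_(n + n, p + p)) (fbar : 'M[R]_(n + n, p + p) -> R) : Prop :=
  exists U : set 'M[R]_(n + n, p + p),
    [/\ open U, U X, smooth_on U fbar &
        forall Y : Sp R p n, U (val Y) -> fbar (val Y) = f Y].

Definition egrad (R : realType) (m q : nat) (F : 'M[R]_(m, q) -> R)
    (X : 'M[R]_(m, q)) : 'M[R]_(m, q) :=
  \matrix_(i, j) 'D_(delta_mx i j) F X.

(* On tangent vectors 'D_Z fbar X depends on f only; the defining equation is
   therefore required for every smooth extension fbar of f around X. *)
Definition is_rgrad (R : realType) (p n : nat) (le_pn : (p <= n)%N) (rho : R)
    (f : Sp R p n -> R) (X : 'M[R]_(n + n, p + p))
    (Xp : 'M[R]_(n + n, (n + n) - (p + p))) : 'M[R]_(n + n, p + p) -> Prop :=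
  unique (fun G => tangent X G /\
    forall fbar, smooth_extension f X fbar ->
    forall Z, tangent X Z -> gmetric le_pn rho X Xp G Z = 'D_Z fbar X).

Definition HX (R : realType) (p n : nat) (rho : R) (X : 'M[R]_(n + n, p + p))
    (Xp : 'M[R]_(n + n, (n + n) - (p + p))) : 'M[R]_(n + n) :=
  (rho / 2) *: (X *m X^T) + J n *m Xp *m Xp^T *m (J n)^T.

Definition SX (R : realType) (p n : nat) (rho : R) (X : 'M[R]_(n + n, p + p))
    (Xp : 'M[R]_(n + n, (n + n) - (p + p))) (G : 'M[R]_(n + n, p + p)) :
    'M[R]_(n + n) :=
  (HX rho X Xp *m G) *m (X *m J p)^T + X *m J p *m (HX rho X Xp *m G)^T.

(* Main.v *)
Require Import Defs.
From HB Require Import structures.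
From mathcomp Require Import all_boot all_order all_algebra.
From mathcomp Require Import all_classical all_reals all_analysis.
From mathcomp Require Import ring.
Import Order.TTheory GRing.Theory Num.Theory.
Import numFieldNormedType.Exports.
Local Open Scope classical_set_scope.
Local Open Scope ring_scope.
Set Implicit Arguments.
Unset Strict Implicit.
Unset Printing Implicit Defensive.

(** The columns of [E = [X J, J Xp]] form a moving frame: every [Z] is uniquely
    [X J W + J Xp K], because [[X^T J^T; Xp^T J^T] E] is block triangular with
    diagonal blocks [1] and [Xp^T Xp] ([unitmx_E]).  In these coordinates
    [W = X^T J^T Z], so the linearised constraint [Z^T J X + X^T J Z = 0] says
    that [W] is symmetric, and tangency should be exactly this condition, with
    [K] free ([tangentP]).

    The metric is [rho^-1 tr(W1^T W2) + tr(K1^T K2)], while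
    [tr(G^T Z) = tr((J^T X^T G)^T W) + tr((Xp^T J^T G)^T K)].  As [W] is
    symmetric, only the symmetric part of [J^T X^T G] is seen by the first
    term.  The gradient must therefore have coordinates
    [rho sym(J^T X^T G)] and [Xp^T J^T G] ([gmetric_gradient]), and it is unique
    since the metric is positive definite ([gmetric_eq0]).  The formula with
    [S_X] comes from the identity [(Y (X J)^T + X J Y^T) J X = X J (A + A^T) + J Xp B]
    for [Y = X J A + J Xp B] ([frame_generator]).

    Two facts connect the algebra with curves.

    - Tangent vectors are velocities of smooth curves, so a curve is needed for
      each [Z] with [W] symmetric.  Such a [Z] is [S J X] with [S] symmetric, by
      [frame_generator] again.  A symmetric [S] is a sum of matrices
      [s v v^T]; since [v^T J v = 0], the transvection [1 + t s v v^T J] is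
      symplectic for every [t], with velocity [s v v^T J] at [0].  The product
      of these transvections, applied to [X], is a polynomial curve in the
      manifold, defined for all [t], with velocity [S J X]
      ([hamiltonian_tangent]).  No matrix exponential or implicit function
      theorem is involved.
    - Two smooth extensions of [f] agree along every curve in the manifold, so
      by the chain rule they have the same derivative in tangent directions
      ([derive_extension]); the Euclidean gradient of one extension thus serves
      for all of them. *)

(** * Linear algebra: the symplectic unit, Gram matrices, symmetric parts *)

Section SymplecticUnit.
Variables (R : realType) (m : nat).

Lemma J_sqr : J m *m J m = - 1%:M :> 'M[R]_(m + m).
Proof.
rewrite /J mulmx_block !mul0mx !mulmx0 mul1mx mulmx1 !addr0 !add0r.
by rewrite scalar_mx_block opp_block_mx !oppr0.
Qed.

Lemma trmx_J : (J m)^T = - J m :> 'M[R]_(m + m).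
Proof.
by rewrite /J tr_block_mx opp_block_mx !trmx0 linearN /= trmx1 !oppr0 opprK.
Qed.

Lemma mulJT : (J m)^T *m J m = 1%:M :> 'M[R]_(m + m).
Proof. by rewrite trmx_J mulNmx J_sqr opprK. Qed.

Lemma mulJT_J q r (M : 'M[R]_(q, m + m)) (N : 'M[R]_(m + m, r)) :
  M *m (J m)^T *m (J m *m N) = M *m N.
Proof. by rewrite mulmxA -(mulmxA M) mulJT mulmx1. Qed.

Lemma J_alternating (v : 'cV[R]_(m + m)) : v^T *m J m *m v = 0.
Proof.
have vJvN : (v^T *m J m *m v)^T = - (v^T *m J m *m v).
  by rewrite !trmx_mul trmxK trmx_J mulNmx mulmxN mulmxA.
move: vJvN; set x := _ *m v => /matrixP xN.
apply/matrixP => i j; move: (xN j i); rewrite !ord1 !mxE => /eqP.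
by rewrite -addr_eq0 -mulr2n mulrn_eq0 /= => /eqP.
Qed.

End SymplecticUnit.

Section Gram.
Variable R : realType.

Lemma mxtrace_gram m q (A : 'M[R]_(m, q)) :
  \tr (A^T *m A) = \sum_(j < q) \sum_(i < m) A i j ^+ 2.
Proof.
apply: eq_bigr => j _; rewrite mxE; apply: eq_bigr => i _.
by rewrite mxE expr2.
Qed.

Lemma mxtrace_gram_ge0 m q (A : 'M[R]_(m, q)) : 0 <= \tr (A^T *m A).
Proof. by rewrite mxtrace_gram; do 2!apply: sumr_ge0 => ? _; exact: sqr_ge0. Qed.

Lemma mxtrace_gram_eq0 m q (A : 'M[R]_(m, q)) : \tr (A^T *m A) = 0 -> A = 0.
Proof.
rewrite mxtrace_gram => /psumr_eq0P Acols0; apply/matrixP => i j.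
have /psumr_eq0P : \sum_(k < m) A k j ^+ 2 = 0.
  by apply: Acols0 => // k _; apply: sumr_ge0 => ? _; exact: sqr_ge0.
move=> /(_ (fun _ _ => sqr_ge0 _)) /(_ i isT) /eqP.
by rewrite sqrf_eq0 mxE => /eqP.
Qed.

(** If the rows of [N] are killed by [A^T A], then [tr((A N^T)^T (A N^T)) = 0],
    so [A N^T = 0], and full column rank gives [N = 0]. *)
Lemma unitmx_gram m q (A : 'M[R]_(m, q)) : \rank A = q -> A^T *m A \in unitmx.
Proof.
move=> rkA; have freeAT : row_free A^T by rewrite /row_free mxrank_tr rkA.
rewrite -row_free_unit -kermx_eq0; set N := kermx _.
have NAA0 : N *m (A^T *m A) = 0 by exact: mulmx_ker.
have AN0 : A *m N^T = 0.
  apply: mxtrace_gram_eq0.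
  by rewrite trmx_mul trmxK !mulmxA -(mulmxA N) NAA0 mul0mx mxtrace0.
apply/eqP/(row_free_inj freeAT).
by rewrite mul0mx -(trmxK (N *m _)) trmx_mul trmxK AN0 trmx0.
Qed.

Lemma trmx_sym q (A : 'M[R]_q) : (sym A)^T = sym A.
Proof. by rewrite /sym linearZ linearD /= trmxK addrC. Qed.

(** Symmetric and skew matrices are orthogonal for the trace form. *)
Lemma mxtrace_sym_mul q (A S : 'M[R]_q) :
  S^T = S -> \tr ((sym A)^T *m S) = \tr (A^T *m S).
Proof.
move=> symS; rewrite /sym linearZ linearD /= trmxK -scalemxAl mulmxDl.
rewrite linearZ linearD /= -[X in _ + X]mxtrace_tr trmx_mul symS mxtrace_mulC.
by field.
Qed.

End Gram.

Lemma unitmx_castmx (F : fieldType) a b (eq_ab : a = b) (L : 'M[F]_(a, b))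
    (A : 'M[F]_(b, a)) : L *m A = 1%:M -> castmx (erefl, eq_ab) A \in unitmx.
Proof.
by case: _ / eq_ab L A => L A LA1; rewrite castmx_id; have [] := mulmx1_unit LA1.
Qed.

Lemma mulmx_castmx (F : fieldType) a b m q (eq_ab : a = b) (A : 'M[F]_(m, a))
    (B : 'M[F]_(b, q)) :
  castmx (erefl, eq_ab) A *m B = A *m castmx (esym eq_ab, erefl) B.
Proof. by case: _ / eq_ab B => B; rewrite !castmx_id. Qed.

(** * Differential calculus of matrix-valued maps *)

Section MatrixCalculus.
Variables (R : realType) (V : normedModType R).

Lemma is_derive_mulmx m q r (A : V -> 'M[R]_(m, q)) (B : V -> 'M[R]_(q, r))
    (dA : 'M[R]_(m, q)) (dB : 'M[R]_(q, r)) (x v : V) :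
  is_derive x v A dA -> is_derive x v B dB ->
  is_derive x v (fun y => A y *m B y) (dA *m B x + A x *m dB).
Proof.
move=> [/[dup] /derivable_mxP Ad /derive_mx -> <-].
move=> [/[dup] /derivable_mxP Bd /derive_mx -> <-].
have ABd i j : is_derive x v (fun y => (A y *m B y) i j)
    (\sum_k (A x i k *: 'D_v (fun y => B y k j) x
           + B x k j *: 'D_v (fun y => A y i k) x)).
  have -> : (fun y => (A y *m B y) i j) =
      \sum_(k < q) ((fun y => A y i k) * (fun y => B y k j)).
    by apply/funext => y; rewrite mxE fct_sumE.
  by apply: is_derive_sum => k; apply: is_deriveM; apply: derivableP.
have dAB : derivable (fun y => A y *m B y) x v.
  by apply/derivable_mxP => i j; have [] := ABd i j.
apply: DeriveDef => //; rewrite derive_mx //.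
apply/matrixP => i j; rewrite mxE; have [_ ->] := ABd i j.
rewrite !mxE -big_split; apply: eq_bigr => k _; rewrite !mxE.
by rewrite /GRing.scale /= mulrC [X in _ + X]mulrC addrC mulrC.
Qed.

Lemma is_derive_trmx m q (A : V -> 'M[R]_(m, q)) (dA : 'M[R]_(m, q)) (x v : V) :
  is_derive x v A dA -> is_derive x v (fun y => (A y)^T) dA^T.
Proof.
move=> [dAx <-]; have /derivable_mxP Ad := dAx.
have entry i j : (fun y => (A y)^T i j) = (fun y => A y j i).
  by apply/funext => y; rewrite mxE.
have dAT : derivable (fun y => (A y)^T) x v.
  by apply/derivable_mxP => i j; rewrite entry.
apply: DeriveDef => //; rewrite !derive_mx //.
by apply/matrixP => i j; rewrite !mxE entry.
Qed.

Lemma derive_along (W : normedModType R) (F : V -> W) (c : R -> V) :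
  differentiable c 0 -> differentiable F (c 0) ->
  'D_(derive1 c 0) F (c 0) = 'D_1 (F \o c) 0.
Proof.
move=> dc dF; rewrite !deriveE //; last exact: differentiable_comp.
by rewrite (diff_comp dc dF) /= derive1E'.
Qed.

End MatrixCalculus.

Lemma derive_egrad (R : realType) m q (F : 'M[R]_(m, q) -> R) (X Z : 'M[R]_(m, q)) :
  differentiable F X -> 'D_Z F X = \tr ((egrad F X)^T *m Z).
Proof.
move=> dF; rewrite deriveE // {1}(matrix_sum_delta Z) exchange_big linear_sum.
apply: eq_bigr => j _; rewrite linear_sum mxE /=; apply: eq_bigr => i _.
by rewrite linearZ /= !mxE deriveE // mulrC.
Qed.

(** * Polynomial curves of matrices *)

Section PolynomialCurves.
Variable R : realType.

Definition curve m q (P : 'M[{poly R}]_(m, q)) (t : R) : 'M[R]_(m, q) :=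
  map_mx (horner_eval t) P.

Lemma curveM m q r (P : 'M[{poly R}]_(m, q)) (Q : 'M[{poly R}]_(q, r)) t :
  curve (P *m Q) t = curve P t *m curve Q t.
Proof. exact: map_mxM. Qed.

Lemma is_derive_curve m q (P : 'M[{poly R}]_(m, q)) (t v : R) :
  is_derive t v (curve P) (curve (map_mx (fun p => v *: deriv p) P) t).
Proof.
have entry i j : (fun s => curve P s i j) = horner (P i j).
  by apply/funext => s; rewrite mxE.
have dentry i j : differentiable (horner (P i j)) t.
  exact/derivable1_diffP/derivable_horner.
have dP : derivable (curve P) t v.
  by apply/derivable_mxP => i j; rewrite entry; exact: diff_derivable.
apply: DeriveDef => //; rewrite derive_mx //; apply/matrixP => i j.
by rewrite !mxE entry deriveE // diff1E // -derivE /horner_eval hornerZ.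
Qed.

(** Directional derivatives of polynomial curves are polynomial curves, which
    is what lets the induction on the order of smoothness close. *)
Lemma smooth_curve m q (U : set R) (P : 'M[{poly R}]_(m, q)) :
  smooth_on U (curve P).
Proof.
have diffP t (Q : 'M[{poly R}]_(m, q)) : differentiable (curve Q) t.
  by apply/derivable1_diffP; have [] := is_derive_curve Q t 1.
move=> k; elim: k P => [|k IHk] P.
  by move=> t _; exact: differentiable_continuous.
split=> // v.
suff -> : 'D_v (curve P) = curve (map_mx (fun p => v *: deriv p) P) by [].
by apply/funext => t; have [] := is_derive_curve P t v.
Qed.

End PolynomialCurves.

(** * Velocities of symplectic curves *)

Section SymplecticVelocity.
Variables (R : realType) (m : nat).
Implicit Types S T : 'M[R]_(m + m).

(** Polynomial curves suffice and are closed under products, so that this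
    predicate is visibly additive in [S]. *)
Definition symplectic_velocity S : Prop :=
  exists P : 'M[{poly R}]_(m + m),
    [/\ forall t, Sp R m m (curve P t), curve P 0 = 1%:M &
        derive1 (curve P) 0 = S *m J m].

Lemma symplectic_velocity0 : symplectic_velocity 0.
Proof.
have c1 t : curve 1%:M t = 1%:M :> 'M[R]_(m + m) by exact: map_mx1.
exists 1%:M; split => // [t|]; first by rewrite /Sp /= c1 trmx1 mul1mx mulmx1.
have -> : curve 1%:M = cst 1%:M :> (R -> 'M[R]_(m + m)) by apply/funext.
by rewrite derive1_cst mul0mx.
Qed.

Lemma symplectic_velocityD S T :
  symplectic_velocity S -> symplectic_velocity T -> symplectic_velocity (S + T).
Proof.
move=> [P [spP P0 dP]] [Q [spQ Q0 dQ]]; exists (P *m Q).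
have cPQ : curve (P *m Q) = fun t => curve P t *m curve Q t.
  by apply/funext => t; exact: curveM.
rewrite cPQ; split=> [t||]; last 2 first.
- by rewrite P0 Q0 mulmx1.
- have [dp dq] : derivable (curve P) 0 1 /\ derivable (curve Q) 0 1.
    by split; [have [] := is_derive_curve P 0 1|have [] := is_derive_curve Q 0 1].
  have [_] := is_derive_mulmx (derivableP dp) (derivableP dq).
  by rewrite -!derive1E dP dQ P0 Q0 mulmx1 mul1mx mulmxDl => ->.
have := spP t; have := spQ t; rewrite /Sp /= => spQt spPt.
have -> : (curve P t *m curve Q t)^T *m J m *m (curve P t *m curve Q t) =
    (curve Q t)^T *m ((curve P t)^T *m J m *m curve P t) *m curve Q t.
  by rewrite trmx_mul !mulmxA.
by rewrite spPt spQt.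
Qed.

(** The curve is [1 + t N] with [N = s v v^T J].  In
    [(1 + t N)^T J (1 + t N)] the terms linear in [t] cancel because
    [s v v^T] is symmetric, and the quadratic one contains [v^T J v = 0]. *)
Lemma symplectic_velocity_transvection (s : R) (v : 'cV[R]_(m + m)) :
  symplectic_velocity (s *: (v *m v^T)).
Proof.
set A := s *: (v *m v^T); set N := A *m J m.
pose P := 1%:M + 'X *: map_mx polyC N : 'M[{poly R}]_(m + m).
have cP t : curve P t = 1%:M + t *: N.
  apply/matrixP => i j.
  by rewrite !mxE /horner_eval hornerD hornerMn hornerM hornerX !hornerC.
have AJA : A *m J m *m A = 0.
  rewrite /A -!scalemxAl -scalemxAr -!mulmxA (mulmxA (J m)) (mulmxA v^T).
  by rewrite (mulmxA v^T) J_alternating mul0mx mulmx0 !scaler0.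
have NT : N^T = - (J m *m A).
  by rewrite trmx_mul linearZ /= trmx_mul trmxK trmx_J mulNmx.
have NJN : N^T *m J m *m N = 0.
  by rewrite NT !mulNmx -!mulmxA (mulmxA A) (mulmxA _ A) AJA mul0mx mulmx0 oppr0.
have dcP : derive1 (curve P) 0 = N.
  rewrite derive1E; have [_ ->] := is_derive_curve P 0 1.
  apply/matrixP => i j.
  rewrite !mxE scale1r derivD derivMn derivM derivX !derivC.
  by rewrite mul0rn mulr0 addr0 mul1r add0r /horner_eval hornerC.
exists P; split=> // [t|]; last by rewrite cP scale0r addr0.
rewrite /Sp /= cP [trmx _]linearD /= trmx1 [trmx _]linearZ /=.
rewrite !mulmxDl !mulmxDr !mul1mx !mulmx1 -!scalemxAl -!scalemxAr NJN.
by rewrite !scaler0 addr0 NT mulNmx /N mulmxA scalerN -addrA addrN addr0.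
Qed.

(** By polarisation, [S] is the sum over [i, j] of [S i j / 4] times
    [(e_i + e_j)(e_i + e_j)^T - (e_i - e_j)(e_i - e_j)^T]. *)
Lemma symplectic_velocity_sym S : S^T = S -> symplectic_velocity S.
Proof.
move=> symS.
pose sq (v : 'cV[R]_(m + m)) := v *m v^T.
pose e i : 'cV[R]_(m + m) := delta_mx i 0.
have sqBB (a b : 'cV[R]_(m + m)) :
    sq (a + b) - sq (a - b) = 2 *: (a *m b^T + b *m a^T).
  rewrite /sq [(a + b)^T]linearD [(a - b)^T]linearB /= !mulmxDl !mulmxDr.
  rewrite !mulNmx !mulmxN; move: (a *m a^T) (a *m b^T) (b *m a^T) (b *m b^T).
  by move=> aa ab ba bb; apply/matrixP => i j; rewrite !mxE; ring.
have -> : S = \sum_i \sum_j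
    ((S i j / 4) *: sq (e i + e j) + (- (S i j / 4)) *: sq (e i - e j)).
  have {1}-> : S = 2^-1 *: (S + S^T).
    by rewrite symS -mulr2n -[S *+ 2]scaler_nat scalerA mulVf ?scale1r // pnatr_eq0.
  rewrite {1 2}(matrix_sum_delta S) linear_sum -big_split scaler_sumr.
  apply: eq_bigr => i _; rewrite linear_sum -big_split scaler_sumr.
  apply: eq_bigr => j _; rewrite /= linearZ /= trmx_delta -scalerDr scalerA.
  rewrite scaleNr -scalerBr sqBB scalerA !trmx_delta !mul_delta_mx.
  by congr (_ *: _); field.
do 2!(elim/big_ind: _ => [|S1 S2|? _];
  [exact: symplectic_velocity0|exact: symplectic_velocityD|]).
by apply: symplectic_velocityD; exact: symplectic_velocity_transvection.
Qed.

End SymplecticVelocity.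

(** * Tangent vectors and smooth extensions *)

Section Tangent.
Variables (R : realType) (p n : nat).
Implicit Types X Z : 'M[R]_(n + n, p + p).

Lemma tangent_velocity X Z : tangent X Z ->
  Z^T *m J n *m X + X^T *m J n *m Z = 0.
Proof.
move=> [c [I [openI I0 smc Spc [<- <-]]]].
have dc : is_derive (0 : R) (1 : R) c (derive1 c 0).
  rewrite derive1E; apply: derivableP; apply/derivable1_diffP.
  by have [+ _] := smc 1%N; exact.
have [_] := is_derive_mulmx (is_derive_mulmx (is_derive_trmx dc)
  (is_derive_cst (J n) _ _)) dc.
rewrite mulmx0 addr0 => <-; rewrite -[RHS](derive_cst (J p) (0 : R) (1 : R)).
apply: near_eq_derive; near=> t; rewrite /=; apply: Spc; near: t.
exact: open_nbhs_nbhs.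
Unshelve. all: by end_near. Qed.

(** The symplectic group acts on the manifold by left multiplication, so the
    orbit of [X] under a curve with velocity [S J] at the identity has velocity
    [S J X]. *)
Lemma hamiltonian_tangent X (S : 'M[R]_(n + n)) : Sp R p n X -> S^T = S ->
  tangent X (S *m J n *m X).
Proof.
move=> SpX /symplectic_velocity_sym[P [spP P0 dP]].
pose Q := P *m map_mx polyC X.
have cQ t : curve Q t = curve P t *m X.
  rewrite curveM; congr (_ *m _); apply/matrixP => i j.
  by rewrite !mxE /horner_eval hornerC.
exists (curve Q), setT; split=> //.
- exact: openT.
- exact: smooth_curve.
- move=> t _; rewrite /Sp /= cQ.
  have -> : (curve P t *m X)^T *m J n *m (curve P t *m X) =
      X^T *m ((curve P t)^T *m J n *m curve P t) *m X.
    by rewrite trmx_mul !mulmxA.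
  by rewrite spP.
split; first by rewrite cQ P0 mul1mx.
have -> : curve Q = fun t => curve P t *m X by apply/funext.
have dP0 : is_derive (0 : R) (1 : R) (curve P) (S *m J n).
  by rewrite -dP derive1E; apply: derivableP; have [] := is_derive_curve P 0 1.
rewrite derive1E.
by have [_ ->] := is_derive_mulmx dP0 (is_derive_cst X _ _); rewrite mulmx0 addr0.
Qed.

Lemma smooth_extension_differentiable f X (F : 'M[R]_(n + n, p + p) -> R) :
  smooth_extension f X F -> differentiable F X.
Proof. by move=> [U [_ UX /(_ 1%N) [dF _] _]]; exact: dF. Qed.

(** Along a curve realising [Z], both extensions restrict to [f] near [0]. *)
Lemma derive_extension (f : Sp R p n -> R) X
    (F1 F2 : 'M[R]_(n + n, p + p) -> R) Z :
  smooth_extension f X F1 -> smooth_extension f X F2 -> tangent X Z ->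
  'D_Z F1 X = 'D_Z F2 X.
Proof.
move=> extF1 extF2 [c [I [openI I0 smc Spc [c0 <-]]]].
have dc : differentiable c 0 by have [+ _] := smc 1%N; exact.
have dF1 := smooth_extension_differentiable extF1.
have dF2 := smooth_extension_differentiable extF2.
rewrite -c0 !derive_along ?c0 //.
have [U1 [openU1 U1X _ F1f]] := extF1; have [U2 [openU2 U2X _ F2f]] := extF2.
have cnear U : open U -> U X -> \forall t \near (0 : R), U (c t).
  move=> openU UX; apply: (differentiable_continuous dc).
  by rewrite c0; exact: open_nbhs_nbhs.
apply: near_eq_derive; near=> t => /=.
have It : I t by near: t; exact: open_nbhs_nbhs.
have U1t : U1 (c t) by near: t; exact: cnear.
have U2t : U2 (c t) by near: t; exact: cnear.
pose Y : Sp R p n := exist _ (c t) (mem_set (Spc t It)).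
by have := F1f Y U1t; have := F2f Y U2t => /= -> ->.
Unshelve. all: by end_near. Qed.

End Tangent.

(** * The frame and the coordinates of tangent vectors *)

Definition frame_vec (R : realType) (p n : nat) (X : 'M[R]_(n + n, p + p))
    (Xp : 'M[R]_(n + n, (n + n) - (p + p))) (A : 'M[R]_(p + p))
    (B : 'M[R]_((n + n) - (p + p), p + p)) : 'M[R]_(n + n, p + p) :=
  X *m J p *m A + J n *m Xp *m B.

Section Frame.
Variables (R : realType) (p n : nat) (le_pn : (p <= n)%N).
Variables (X : 'M[R]_(n + n, p + p)) (SpX : Sp R p n X).
Variables (Xp : 'M[R]_(n + n, (n + n) - (p + p))) (perpX : is_perp X Xp).
Implicit Types Z G : 'M[R]_(n + n, p + p).
Implicit Types (A : 'M[R]_(p + p)) (B : 'M[R]_((n + n) - (p + p), p + p)).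

Let XJX : X^T *m J n *m X = J p := SpX.
Local Notation frame := (frame_vec X Xp).
Local Notation W Z := (usubmx (coords le_pn X Xp Z)).
Local Notation K Z := (dsubmx (coords le_pn X Xp Z)).

Lemma perp_trmx_mul : X^T *m Xp = 0.
Proof.
apply/matrixP => i j; rewrite [RHS]mxE.
have -> : (X^T *m Xp) i j = ((col i X)^T *m col j Xp) 0 0.
  by rewrite !mxE; apply: eq_bigr => k _; rewrite !mxE.
have [_ perp] := perpX; rewrite (perp (col j Xp)).1 ?mxE //.
  by rewrite tr_col row_sub.
by rewrite tr_col row_sub.
Qed.

Lemma left_inverse_XJ : X^T *m (J n)^T *m (X *m J p) = 1%:M.
Proof. by rewrite trmx_J mulmxN mulNmx !mulmxA XJX J_sqr opprK. Qed.

Lemma frame_W A B : X^T *m (J n)^T *m frame A B = A.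
Proof.
rewrite mulmxDr (mulmxA _ (X *m J p)) left_inverse_XJ mul1mx.
by rewrite (mulmxA _ (J n *m Xp)) mulJT_J perp_trmx_mul mul0mx addr0.
Qed.

(** Multiplying [E] on the left by [M = [X^T J^T; Xp^T J^T]] gives a block lower
    triangular matrix with diagonal blocks [1] and [Xp^T Xp]. *)
Lemma unitmx_E : E le_pn X Xp \in unitmx.
Proof.
pose M := col_mx (X^T *m (J n)^T) (Xp^T *m (J n)^T).
pose D := M *m row_mx (X *m J p) (J n *m Xp).
have D_unit : D \in unitmx.
  rewrite /D mul_col_row left_inverse_XJ !mulJT_J perp_trmx_mul.
  rewrite unitmxE det_lblock det1 mul1r -unitmxE.
  by apply: unitmx_gram; have [] := perpX.
by apply: (@unitmx_castmx _ _ _ _ (invmx D *m M)); rewrite -mulmxA mulVmx.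
Qed.

Lemma coordsK Z : frame (W Z) (K Z) = Z.
Proof.
rewrite /frame_vec -mul_row_col vsubmxK /coords -mulmx_castmx.
by rewrite -/(E le_pn X Xp) mulKVmx // unitmx_E.
Qed.

Lemma coords_frame A B : coords le_pn X Xp (frame A B) = col_mx A B.
Proof.
have <- : E le_pn X Xp *m castmx (dimE le_pn, erefl) (col_mx A B) = frame A B.
  rewrite /E mulmx_castmx /frame_vec -mul_row_col; congr (_ *m _).
  exact: (castmxK (dimE le_pn) erefl).
rewrite /coords mulKmx ?unitmx_E //; exact: (castmxK (dimE le_pn) erefl).
Qed.

Lemma coords_W Z : W Z = X^T *m (J n)^T *m Z.
Proof. by rewrite -[in RHS](coordsK Z) frame_W. Qed.

(** With [Y = frame A B] one has [(X J)^T J X = 1] and [Y^T J X = A^T], so the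
    two terms of the sum contribute [Y] and [X J A^T]. *)
Lemma frame_generator A B :
  (frame A B *m (X *m J p)^T + X *m J p *m (frame A B)^T) *m J n *m X =
  frame (A + A^T) B.
Proof.
have AT : (frame A B)^T *m (J n *m X) = A^T.
  by rewrite -[in RHS](frame_W A B) !trmx_mul !trmxK !mulmxA.
have XJT : (X *m J p)^T *m (J n *m X) = 1%:M.
  by rewrite trmx_mul -mulmxA (mulmxA X^T) XJX mulJT.
rewrite -mulmxA mulmxDl -(mulmxA (frame A B)) -(mulmxA (X *m J p)) AT XJT.
by rewrite mulmx1 /frame_vec mulmxDr addrAC.
Qed.

(** The direct implication is the linearised constraint.  Conversely, halving
    the symmetric coordinate makes [frame_generator] exhibit [Z] as [S J X] with
    [S] symmetric. *)
Lemma tangentP Z : tangent X Z <-> (W Z)^T = W Z.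
Proof.
split=> [/tangent_velocity velZ|symW].
  rewrite coords_W !trmx_mul !trmxK mulmxA trmx_J.
  move/eqP: velZ; rewrite addr_eq0 => /eqP ->.
  by rewrite mulmxN mulNmx.
pose Y := frame (2^-1 *: W Z) (K Z).
pose S := Y *m (X *m J p)^T + X *m J p *m Y^T.
have symS : S^T = S.
  by rewrite /S linearD /= (trmx_mul Y) (trmx_mul (X *m J p)) !trmxK addrC.
suff <- : S *m J n *m X = Z by exact: hamiltonian_tangent.
rewrite frame_generator linearZ /= symW -scalerDl.
have -> : 2^-1 + 2^-1 = 1 :> R by field.
by rewrite scale1r coordsK.
Qed.

Lemma tangentB Z1 Z2 : tangent X Z1 -> tangent X Z2 -> tangent X (Z1 - Z2).
Proof.
move=> /tangentP + /tangentP + ; rewrite !coords_W => W1 W2; apply/tangentP.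
by rewrite coords_W mulmxBr linearB /= W1 W2.
Qed.

(** * The metric and the gradient in coordinates *)

Variables (rho : R) (rho_gt0 : 0 < rho).

Lemma gmetric_frame A B Z :
  gmetric le_pn rho X Xp (frame A B) Z =
  rho^-1 * \tr (A^T *m W Z) + \tr (B^T *m K Z).
Proof. by rewrite /gmetric coords_frame col_mxKu col_mxKd. Qed.

Lemma gmetric_eq0 Z : gmetric le_pn rho X Xp Z Z = 0 -> Z = 0.
Proof.
rewrite /gmetric /= => /eqP.
rewrite paddr_eq0 ?mulr_ge0 ?mxtrace_gram_ge0 ?invr_ge0 ?ltW //.
rewrite mulf_eq0 invr_eq0 gt_eqF //= => /andP[/eqP/mxtrace_gram_eq0 W0].
move=> /eqP/mxtrace_gram_eq0 K0.
by rewrite -(coordsK Z) W0 K0 /frame_vec !mulmx0 addr0.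
Qed.

Lemma gmetricBl Z1 Z2 Z :
  gmetric le_pn rho X Xp (Z1 - Z2) Z =
  gmetric le_pn rho X Xp Z1 Z - gmetric le_pn rho X Xp Z2 Z.
Proof.
rewrite -(coordsK Z1) -(coordsK Z2).
have -> A1 B1 A2 B2 : frame A1 B1 - frame A2 B2 = frame (A1 - A2) (B1 - B2).
  by rewrite /frame_vec !mulmxBr opprD addrACA.
have trB m (C D Y : 'M[R]_(m, p + p)) :
    \tr ((C - D)^T *m Y) = \tr (C^T *m Y) - \tr (D^T *m Y).
  by rewrite [(C - D)^T]linearB mulmxBl linearB.
by rewrite !gmetric_frame !trB mulrBr opprD addrACA.
Qed.

(** Symmetry of [W Z] is what allows [J^T X^T G] to be replaced by its
    symmetric part, which makes the representing vector tangent. *)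
Lemma gmetric_gradient G Z : tangent X Z ->
  gmetric le_pn rho X Xp
    (frame (rho *: sym ((J p)^T *m X^T *m G)) (Xp^T *m (J n)^T *m G)) Z =
  \tr (G^T *m Z).
Proof.
move=> /tangentP symW; rewrite gmetric_frame linearZ /= -scalemxAl linearZ /=.
rewrite mulKf ?gt_eqF // mxtrace_sym_mul // -[in RHS](coordsK Z).
by rewrite /frame_vec mulmxDr linearD /= !trmx_mul !trmxK !mulmxA.
Qed.

Lemma frame_HX G :
  HX rho X Xp *m G =
  frame ((rho / 2) *: ((J p)^T *m X^T *m G)) (Xp^T *m (J n)^T *m G).
Proof.
rewrite /HX /frame_vec mulmxDl -scalemxAl -scalemxAr !mulmxA.
congr (_ *: _ + _).
by rewrite trmx_J mulmxN -(mulmxA X (J p)) J_sqr mulmxN mulmx1 opprK.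
Qed.

Lemma frame_SX G :
  SX rho X Xp G *m J n *m X =
  frame (rho *: sym ((J p)^T *m X^T *m G)) (Xp^T *m (J n)^T *m G).
Proof.
by rewrite /SX frame_HX frame_generator linearZ /= -scalerDr -scalerA.
Qed.

End Frame.

Theorem proposition4p5 (R : realType) (p n : nat)
    (p_gt0 : (0 < p)%N) (le_pn : (p <= n)%N) (rho : R) (rho_gt0 : 0 < rho)
    (f : Sp R p n -> R) (X : 'M[R]_(n + n, p + p)) (XSp : Sp R p n X)
    (Xp : 'M[R]_(n + n, (n + n) - (p + p))) (Xp_perp : is_perp X Xp)
    (fbar : 'M[R]_(n + n, p + p) -> R) (fbar_ext : smooth_extension f X fbar) :
  let G := egrad fbar X in
  let gradf := rho *: (X *m J p *m sym ((J p)^T *m X^T *m G))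
               + J n *m Xp *m Xp^T *m (J n)^T *m G in
  is_rgrad le_pn rho f X Xp gradf /\ gradf = SX rho X Xp G *m J n *m X.
Proof.
move=> G gradf.
pose A := rho *: sym ((J p)^T *m X^T *m G).
have gradE : gradf = frame_vec X Xp A (Xp^T *m (J n)^T *m G).
  by rewrite /gradf /frame_vec scalemxAr !mulmxA.
have symA : A^T = A by rewrite linearZ /= trmx_sym.
have tan_grad : tangent X gradf.
  by apply/(tangentP le_pn XSp Xp_perp); rewrite gradE coords_frame // col_mxKu.
have gradP Z : tangent X Z -> gmetric le_pn rho X Xp gradf Z = 'D_Z fbar X.
  move=> tanZ; rewrite gradE gmetric_gradient // derive_egrad //.
  exact: smooth_extension_differentiable fbar_ext.
split; last by rewrite gradE frame_SX.
split; first split=> // F extF Z tanZ.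
  by rewrite gradP // (derive_extension fbar_ext extF).
move=> G' [tanG' G'P]; have tanB := tangentB le_pn XSp Xp_perp tan_grad tanG'.
apply/eqP; rewrite -subr_eq0; apply/eqP/(gmetric_eq0 XSp Xp_perp rho_gt0).
by rewrite gmetricBl // gradP // (G'P fbar) // subrr.
Qed.
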